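(* Let $N\ge k\ge 2$ be integers and let $d$ be an integer. Then the constant sequence $(d,d,\ldots,d)$ of length $N$ is the degree sequence of a $k$-uniform hypergraph on the vertex set $[N]$ if and only if $k\mid dN$.
   Context: $[N]=\{1,\dots,N\}$. A hypergraph on a finite set $X$ is a family $E=\{E_1,\ldots,E_m\}$ of non-empty subsets of $X$, called its edges; it is $k$-uniform ($k\ge 2$) if $E\subset\binom{X}{k}$, where $\binom{X}{k}$ is the set of all $k$-element subsets of $X$. The degree of a vertex is the number of edges containing it, and the degree sequence of a hypergraph on $[N]$ is the tuple of degrees of the vertices $1,\dots,N$.
   Formalization: The formal statement assumes 0 ≤ d ≤ C(N−1,k−1), the range of possible vertex degrees; without this the claim is false, e.g. N = k = 2, d = 2 (2 divides 4 but {1,2} is the only possible edge), or d = −2. *)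

(* Defs.v *)
From mathcomp Require Import all_boot all_order all_algebra.

Set Implicit Arguments.
Unset Strict Implicit.
Unset Printing Implicit Defensive.

(* A family of edges is a set of subsets of T: an edge cannot be repeated. *)
Definition is_hypergraph (T : finType) (E : {set {set T}}) : Prop :=
  set0 \notin E.

Definition k_subsets (T : finType) (k : nat) : {set {set T}} :=
  [set e : {set T} | #|e| == k].

Definition k_uniform (T : finType) (k : nat) (E : {set {set T}}) : Prop :=
  E \subset k_subsets T k.

Definition degree (T : finType) (E : {set {set T}}) (x : T) : nat :=
  #|[set e in E | x \in e]|.

(* The vertices 1, ..., N are represented by the elements 0, ..., N - 1 of
   'I_N; degrees are cast to int so that a sequence of arbitrary integers can
   be compared with a degree sequence. *)
Definition degree_sequence (N : nat) (E : {set {set 'I_N}}) : N.-tuple int :=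
  [tuple ((degree E i)%:Z)%R | i < N].

(* Main.v *)
Require Import Defs.
From mathcomp Require Import all_boot all_order all_algebra.
From mathcomp Require Import perm zify.

Import Order.TTheory GRing.Theory Num.Theory.

(** Counting the incidences of vertices and edges gives [d N = k m] for m edges.
  Conversely, among the k-uniform hypergraphs with [m = d N / k] edges take one
  minimizing the total excess of the degrees over d.  If some vertex i has
  degree above d, then some j has degree below d.  As [deg i > deg j], some edge
  containing i but not j is mapped by the transposition (i j) to a non-edge;
  replacing the edge by its image lowers the excess. *)

Section Degrees.

Set Implicit Arguments.
Unset Strict Implicit.

Variable T : finType.
Implicit Types (E : {set {set T}}) (e : {set T}) (x i j : T).

Lemma degree_sum E x : degree E x = \sum_(e in E) (x \in e).
Proof.
rewrite /degree -sum1_card big_mkcond [RHS]big_mkcond /=.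
by apply: eq_bigr => e _; rewrite inE; do 2!case: (_ \in _).
Qed.

Lemma handshake k E : k_uniform k E -> \sum_x degree E x = k * #|E|.
Proof.
move=> /subsetP Ek.
under eq_bigr do rewrite degree_sum.
rewrite exchange_big /= (eq_bigr (fun=> k)) => [|e /Ek].
  by rewrite sum_nat_const mulnC.
by rewrite inE => /eqP <-; rewrite -sum1_card [RHS]big_mkcond.
Qed.

Definition swap i j e : {set T} := tperm i j @: e.

Lemma in_swap i j e x : (x \in swap i j e) = (tperm i j x \in e).
Proof. by rewrite -{1}(tpermK i j x) mem_imset //; exact: perm_inj. Qed.

Lemma card_swap i j e : #|swap i j e| = #|e|.
Proof. by rewrite card_imset //; exact: perm_inj. Qed.

Lemma swap_inj i j : injective (swap i j).
Proof. exact/imset_inj/perm_inj. Qed.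

(** Edges containing both vertices count equally in the two degrees, so more edges contain [i]
    without [j] than [j] without [i]. As [swap i j] is injective, it cannot send all of the former
    into the latter. *)
Lemma exists_swappable E i j : degree E j < degree E i ->
  exists e, [/\ e \in E, i \in e, j \notin e & swap i j e \notin E].
Proof.
move=> ltji.
have [/existsP[e /and4P[]]|/existsPn noe] :=
  boolP [exists e, [&& e \in E, i \in e, j \notin e & swap i j e \notin E]].
  by exists e.
have degD a b : degree E a = #|[set e in E | (a \in e) && (b \in e)]|
    + #|[set e in E | (a \in e) && (b \notin e)]|.
  rewrite /degree -(cardsID [set e : {set T} | b \in e]); congr (_ + _); apply: eq_card => e;
  by rewrite !inE; do 3!case: (_ \in _).
have le_ij : #|[set e in E | (i \in e) && (j \notin e)]|
    <= #|[set e in E | (j \in e) && (i \notin e)]|.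
  rewrite -(card_imset _ (@swap_inj i j)); apply/subset_leq_card/subsetP => f.
  case/imsetP => e /[!inE] /and3P[eE ie je] ->.
  rewrite !in_swap tpermL tpermR ie je !andbT.
  by have := noe e; rewrite eE ie je /= negbK.
have eq_ij : #|[set e in E | (i \in e) && (j \in e)]|
    = #|[set e in E | (j \in e) && (i \in e)]|.
  by apply: eq_card => e; rewrite !inE [(i \in e) && _]andbC.
by move: ltji; rewrite (degD i j) (degD j i) eq_ij ltn_add2l ltnNge le_ij.
Qed.

(** The balance is stated additively to avoid truncated subtraction. *)
Lemma degree_exchange E e f x : e \in E -> f \notin E ->
  degree (f |: E :\ e) x + (x \in e) = degree E x + (x \in f).
Proof.
move=> eE fE; rewrite !degree_sum big_setU1 /=; last by rewrite !inE (negPf fE) andbF.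
by rewrite (big_setD1 e eE) /= addnC addnCA [RHS]addnC.
Qed.

Lemma card_exchange E e f : e \in E -> f \notin E -> #|f |: E :\ e| = #|E|.
Proof.
move=> eE fE; rewrite cardsU1 !inE (negPf fE) andbF /=.
by rewrite [RHS](cardsD1 e) eE.
Qed.

Lemma exists_k_uniform k m : m <= 'C(#|T|, k) ->
  exists E, k_uniform k E /\ #|E| = m.
Proof.
(* The bound makes a binomial coefficient positive: the one counting the [m]-element sets of
   [k]-subsets. *)
rewrite -card_draws -bin_gt0 -cards_draws => /card_gt0P[E].
by rewrite inE => /andP[Ek /eqP Em]; exists E.
Qed.

(** This is the equality case of summing the termwise bounds. *)
Lemma le_sum_const_eq (f : T -> nat) d : (forall x, f x <= d) ->
  \sum_x f x = d * #|T| -> forall x, f x = d.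
Proof.
move=> fd sumf x; apply/eqP; move: x; apply/forallP.
have [_ <-] := leqif_sum (fun x (_ : true) => leqif_eq (fd x)).
by rewrite sumf sum_nat_const mulnC.
Qed.

Lemma exists_regular k m d : k * m = d * #|T| -> m <= 'C(#|T|, k) ->
  exists E, k_uniform k E /\ forall x, degree E x = d.
Proof.
move=> kmd /exists_k_uniform[E0 [E0k E0m]].
pose P E := (E \subset k_subsets T k) && (#|E| == m).
have P0 : P E0 by rewrite /P E0m eqxx andbT.
(* Subtraction is truncated, so vertices of degree at most [d] contribute 0. *)
case: (arg_minnP (fun E => \sum_x (degree E x - d)) P0) => E /andP[Ek /eqP Em] minE.
have sumE : \sum_x degree E x = d * #|T| by rewrite (handshake Ek) Em.
exists E; split=> //.
case: (boolP [forall x, degree E x <= d]) => [/forallP led|].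
  exact: le_sum_const_eq.
rewrite negb_forall => /existsP[i]; rewrite -ltnNge => ltdi.
have [j ltjd] : exists j, degree E j < d.
  (* If every degree were at least [d], the total [d * #|T|] would leave at most [d] for vertex
     [i]. *)
  apply/existsP; apply: contraLR ltdi; rewrite negb_exists => /forallP ged.
  rewrite -leqNgt (bigD1 i) //= in sumE *.
  have : \sum_(x | x != i) d <= \sum_(x | x != i) degree E x.
    by apply: leq_sum => x _; rewrite leqNgt.
  have : \sum_(x : T) d = d * #|T| by rewrite sum_nat_const mulnC.
  by rewrite (bigD1 i) //=; lia.
have [e [eE ie je sE]] := @exists_swappable E i j (ltn_trans ltjd ltdi).
set E' := swap i j e |: E :\ e.
have degE' x : degree E' x + (x \in e) = degree E x + (tperm i j x \in e).
  by rewrite degree_exchange // in_swap.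
have P' : P E'.
  rewrite /P card_exchange // Em eqxx andbT subUset sub1set.
  rewrite (subset_trans (subsetDl _ _) Ek) andbT inE card_swap.
  by have := subsetP Ek e eE; rewrite inE.
have := minE E' P'; rewrite leqNgt => /negP[].
(* The term at [i] drops by exactly one. At [j] the degree grows by one but stays at most [d], so
   its excess remains 0; all other degrees are unchanged. *)
rewrite (bigD1 i) //= [ltnRHS](bigD1 i) //= -addSn leq_add //.
  by have := degE' i; rewrite tpermL ie (negPf je); lia.
apply: leq_sum => x xi; have := degE' x.
case: (eqVneq x j) => [->|xj]; first by rewrite tpermR ie (negPf je); lia.
by rewrite tpermD 1?eq_sym // => /addIn ->.
Qed.

End Degrees.

Local Open Scope ring_scope.

Theorem corollary3p1 (N k : nat) (d : int)
    (hk : (2 <= k)%N) (hN : (k <= N)%N)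
    (hd0 : 0 <= d) (hd1 : d <= ('C(N.-1, k.-1))%:Z) :
  (exists E : {set {set 'I_N}},
     [/\ is_hypergraph E, k_uniform k E
       & degree_sequence E = [tuple of nseq N d]])
  <-> (k%:Z %| d * N%:Z)%Z.
Proof.
case: d hd0 hd1 => // d _; rewrite lez_nat => hd1.
have degP (E : {set {set 'I_N}}) :
    degree_sequence E = [tuple of nseq N d%:Z] <-> forall i, degree E i = d.
  split=> [eqE i|degE].
    by have := congr1 (fun t => tnth t i) eqE; rewrite tnth_mktuple tnth_nseq => -[].
  by apply: eq_from_tnth => i; rewrite tnth_mktuple tnth_nseq degE.
have -> : (k%:Z %| d%:Z * N%:Z)%Z = (k %| d * N)%N by rewrite -PoszM.
split=> [[E [_ Ek /degP degE]]|/dvdnP[m dNm]].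
  have := handshake Ek; rewrite (eq_bigr (fun=> d)) //.
  by rewrite sum_nat_const card_ord mulnC => ->; rewrite dvdn_mulr.
have k_gt0 : (0 < k)%N by apply: ltnW.
have m_le : (m <= 'C(N, k))%N.
  (* After multiplying by [k], the bound [hd1] suffices, because
     [k * 'C(N, k) = N * 'C(N.-1, k.-1)]. *)
  rewrite -(leq_pmul2l k_gt0) [(k * m)%N]mulnC -dNm.
  case: N k hN k_gt0 hd1 {hk degP dNm} => [|N] [|k] //= _ _ hd1.
  by rewrite -mul_bin_diag mulnC leq_mul2l hd1.
have [||E [Ek degE]] := @exists_regular 'I_N k m d; rewrite ?card_ord //.
  by rewrite mulnC.
exists E; split=> //; last exact/degP.
by apply/negP => /(subsetP Ek); rewrite inE cards0 => /eqP k0; rewrite -k0 in k_gt0.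
Qed.
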